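(* Let $\mathcal{M}$ be a strict monoidal category with unit object $I$. The category $\mathcal{M}^p$ of pivotal objects in $\mathcal{M}$ has a structure of a strict pivotal category as follows. The unit object is $I^p:=(I,I,\mathrm{id}_I,\mathrm{id}_I,\mathrm{id}_I,\mathrm{id}_I)$. The tensor product of $X^p=(X,X^*,d_X,b_X,d_{X^*},b_{X^*})$ and $Y^p=(Y,Y^*,d_Y,b_Y,d_{Y^*},b_{Y^*})$ is $$X^p\otimes Y^p=(X\otimes Y,\;Y^*\otimes X^*,\;d_{X\otimes Y},\;b_{X\otimes Y},\;d_{Y^*\otimes X^*},\;b_{Y^*\otimes X^*}),$$ where $$d_{X\otimes Y}=d_Y(Y^*\otimes d_X\otimes Y),\quad b_{X\otimes Y}=(X\otimes b_Y\otimes X^* )b_X,$$ $$d_{Y^*\otimes X^*}=d_{X^*}(X\otimes d_{Y^*}\otimes X^* ),\quad b_{Y^*\otimes X^*}=(Y^*\otimes b_{X^*}\otimes Y)b_{Y^*}.$$ The tensor product of morphisms in $\mathcal{M}^p$ is the tensor product in $\mathcal{M}$. The left dual of $X^p$ is $$(X^p)^*=(X^*,X,d_{X^*},b_{X^*},d_X,b_X),$$ and the evaluation and coevaluation morphisms are $d_{X^p}=d_X$, $b_{X^p}=b_X$, $d_{(X^p)^*}=d_{X^*}$, $b_{(X^p)^*}=b_{X^*}$. It follows that the dual $f^*:(Y^p)^*\to(X^p)^*$ of any morphism $f:X^p\to Y^p$ in $\mathcal{M}^p$ is the same as the dual $f^*:Y^*\to X^*$ of $f:X\to Y$ in $\m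athcal{M}$.
   Context: An object also denotes its identity morphism; juxtaposition of morphisms is composition. A duality in a strict monoidal category $\mathcal{M}$ is a quadruple $(X,X^*,d_X,b_X)$ of objects $X,X^*$ and morphisms $d_X:X^*\otimes X\to I$, $b_X:I\to X\otimes X^*$ such that $(X\otimes d_X)(b_X\otimes X)=\mathrm{id}_X$ and $(d_X\otimes X^* )(X^*\otimes b_X)=\mathrm{id}_{X^*}$; then $(X^*,d_X,b_X)$ is called a left dual of $X$. Given dualities for $X$ and $Y$, the left dual of $f:X\to Y$ is $f^*=(d_Y\otimes X^* )(Y^*\otimes f\otimes X^* )(Y^*\otimes b_X):Y^*\to X^*$. A pivotal object in $\mathcal{M}$ is a sextuple $X^p=(X,X^*,d_X,b_X,d_{X^*},b_{X^*})$ of objects $X,X^*$ and morphisms $d_X:X^*\otimes X\to I$, $b_X:I\to X\otimes X^*$, $d_{X^*}:X\otimes X^*\to I$, $b_{X^*}:I\to X^*\otimes X$ such that both $(X,X^*,d_X,b_X)$ and $(X^*,X,d_{X^*},b_{X^*})$ are dualities. A morphism $f:X^p\to Y^p$ of pivotal objects is a morphism $f:X\to Y$ in $\mathcal{M}$ with $f=f^{**}$, where $f^{**}=(f^* )^*=(d_{X^*}\otimes Y)(X\otimes f^*\otimes Y)(X\otimes b_{Y^*})$. Pivotal objects and these morphisms (composed as in $\mathcal{M}$) form the category $\mathcal{M}^p$. The opposite $\mathcal{M}^{\mathrm{op}}$ of a strict monoidal category is strict monoidal with the reversed tensor product $X\otimes^{\mathrm{op}}Y=Y\otimes X$, $f\otimes^{\mathrm{op}}g=g\otimes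 f$. A strict pivotal category is a strict monoidal category $\mathcal{N}$ with a chosen left dual $(X^*,d_X,b_X)$ of each object $X$ (hence a left duality functor $(-)^*:\mathcal{N}^{\mathrm{op}}\to\mathcal{N}$, sending $f$ to $f^*$) such that: (1) $(-)^*:\mathcal{N}^{\mathrm{op}}\to\mathcal{N}$ is a strict monoidal functor; (2) $d_I=b_I=\mathrm{id}_I$; (3) $d_{X\otimes Y}=d_Y(Y^*\otimes d_X\otimes Y)$ and $b_{X\otimes Y}=(X\otimes b_Y\otimes X^* )b_X$ for all objects $X,Y$; (4) $(-)^{**}=\mathrm{Id}_{\mathcal{N}}$. *)

(* Defs.v *)
(* Proof irrelevance makes the casts [eqh] below independent of the equality
   proofs they are built from. *)
From Stdlib Require Import ProofIrrelevance.

Set Implicit Arguments.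
Unset Strict Implicit.
Unset Printing Implicit Defensive.

Record category := Category {
  ob :> Type;
  hom : ob -> ob -> Type;
  idm : forall X, hom X X;
  comp : forall X Y Z, hom Y Z -> hom X Y -> hom X Z;
  comp_idl : forall X Y (f : hom X Y), comp (idm Y) f = f;
  comp_idr : forall X Y (f : hom X Y), comp f (idm X) = f;
  comp_assoc : forall W X Y Z (h : hom Y Z) (g : hom X Y) (f : hom W X),
    comp h (comp g f) = comp (comp h g) f
}.
Arguments hom {C} X Y : rename.
Arguments idm {C} X : rename.
Arguments comp {C X Y Z} g f : rename.

Notation "g ∘ f" := (comp g f) (at level 40, left associativity).

(* Equality of morphisms whose sources and targets are equal, but not
   syntactically the same objects. *)
Inductive same_mor (C : category) (X Y : C) (f : hom X Y) :
    forall X' Y' : C, hom X' Y' -> Prop :=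
  same_mor_refl : same_mor f f.

Notation "f ≡ g" := (same_mor f g) (at level 70, no associativity).

(* The identity morphism of [X], regarded as a morphism to an equal object;
   it is only used to compose morphisms up to strict associativity/unitality. *)
Definition eqh (C : category) (X Y : C) (e : X = Y) : hom X Y :=
  match e in _ = Z return hom X Z with eq_refl => idm X end.

Definition op_category (C : category) : category :=
  @Category (ob C) (fun X Y => @hom C Y X) (fun X => idm X)
    (fun X Y Z g f => @comp C Z Y X f g)
    (fun X Y f => comp_idr f) (fun X Y f => comp_idl f)
    (fun W X Y Z h g f => eq_sym (@comp_assoc C Z Y X W f g h)).

Record functor (C D : category) := Functor {
  fob :> C -> D;
  fmap : forall X Y : C, hom X Y -> hom (fob X) (fob Y);
  fmap_id : forall X : C, fmap (idm X) = idm (fob X);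
  fmap_comp : forall (X Y Z : C) (g : hom Y Z) (f : hom X Y),
    fmap (g ∘ f) = fmap g ∘ fmap f
}.

Record strict_monoidal (C : category) := StrictMonoidal {
  unit_ob : C;
  tens : C -> C -> C;
  tensm : forall X X' Y Y' : C,
    hom X X' -> hom Y Y' -> hom (tens X Y) (tens X' Y');
  tensm_id : forall X Y : C, tensm (idm X) (idm Y) = idm (tens X Y);
  tensm_comp : forall (X X' X'' Y Y' Y'' : C)
    (f' : hom X' X'') (f : hom X X') (g' : hom Y' Y'') (g : hom Y Y'),
    tensm (f' ∘ f) (g' ∘ g) = tensm f' g' ∘ tensm f g;
  tens_assoc : forall X Y Z : C, tens (tens X Y) Z = tens X (tens Y Z);
  tens_unitl : forall X : C, tens unit_ob X = X;
  tens_unitr : forall X : C, tens X unit_ob = X;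
  tensm_assoc : forall (X X' Y Y' Z Z' : C)
    (f : hom X X') (g : hom Y Y') (h : hom Z Z'),
    tensm (tensm f g) h ≡ tensm f (tensm g h);
  tensm_unitl : forall (X Y : C) (f : hom X Y), tensm (idm unit_ob) f ≡ f;
  tensm_unitr : forall (X Y : C) (f : hom X Y), tensm f (idm unit_ob) ≡ f
}.
Arguments unit_ob {C} M : rename.
Arguments tens {C} M X Y : rename.
Arguments tensm {C} M {X X' Y Y'} f g : rename.
Arguments tens_assoc {C} M X Y Z : rename.
Arguments tens_unitl {C} M X : rename.
Arguments tens_unitr {C} M X : rename.

Notation "X ⊗[ M ] Y" := (tens M X Y)
  (at level 35, right associativity, format "X  ⊗[ M ]  Y").
Notation "f ⊠[ M ] g" := (tensm M f g)
  (at level 35, right associativity, format "f  ⊠[ M ]  g").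

Record is_strict_monoidal_functor (C D : category)
    (M : strict_monoidal C) (N : strict_monoidal D) (F : functor C D) : Prop := {
  smf_unit : F (unit_ob M) = unit_ob N;
  smf_tens : forall X Y : C, F (X ⊗[M] Y) = F X ⊗[N] F Y;
  smf_tensm : forall (X X' Y Y' : C) (f : hom X X') (g : hom Y Y'),
    fmap F (f ⊠[M] g) ≡ fmap F f ⊠[N] fmap F g
}.

Lemma same_mor_op (C : category) (X Y X' Y' : C) (f : hom X Y) (g : hom X' Y') :
  f ≡ g -> @same_mor (op_category C) Y X f Y' X' g.
Proof. intros []; constructor. Qed.

Lemma same_mor_sym (C : category) (X Y X' Y' : C) (f : hom X Y) (g : hom X' Y') :
  f ≡ g -> g ≡ f.
Proof. intros []; constructor. Qed.

Definition op_monoidal (C : category) (M : strict_monoidal C) :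
    strict_monoidal (op_category C).
Proof.
refine (@StrictMonoidal (op_category C) (unit_ob M)
  (fun X Y => Y ⊗[M] X) (fun X X' Y Y' f g => g ⊠[M] f) _ _ _ _ _ _ _ _).
- intros; apply (tensm_id M).
- intros; apply (tensm_comp M).
- intros; symmetry; apply (tens_assoc M).
- intros; apply (tens_unitr M).
- intros; apply (tens_unitl M).
- intros; apply same_mor_op, same_mor_sym, (@tensm_assoc C M).
- intros X Y f; apply same_mor_op, (@tensm_unitr C M Y X f).
- intros X Y f; apply same_mor_op, (@tensm_unitl C M Y X f).
Defined.

Section Casts.
Context (C : category) (M : strict_monoidal C).
Implicit Types X Y Z : C.
Local Notation "X ⊗ Y" := (tens M X Y) (at level 35, right associativity).
Local Notation "f ⊠ g" := (tensm M f g) (at level 35, right associativity).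

Lemma eqh_irr X Y (e e' : X = Y) : eqh e = eqh e'.
Proof. now rewrite (proof_irrelevance _ e e'). Qed.

Lemma eqh_idm X (e : X = X) : eqh e = idm X.
Proof. now rewrite (proof_irrelevance _ e eq_refl). Qed.

Lemma eqh_comp X Y Z (e : X = Y) (e' : Y = Z) :
  eqh e' ∘ eqh e = eqh (eq_trans e e').
Proof. destruct e'; apply comp_idl. Qed.

Lemma same_mor_square X Y X' Y' (f : hom X Y) (g : hom X' Y')
    (eX : X = X') (eY : Y = Y') : f ≡ g -> eqh eY ∘ f = g ∘ eqh eX.
Proof.
intros fg; revert eX eY; destruct fg; intros eX eY.
now rewrite !eqh_idm, comp_idl, comp_idr.
Qed.

Lemma tensm_eqhr X Y Z (e : Y = Z) :
  idm X ⊠ eqh e = eqh (f_equal (fun W => X ⊗ W) e).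
Proof. destruct e; apply tensm_id. Qed.

Lemma tensm_eqhl X Y Z (e : Y = Z) :
  eqh e ⊠ idm X = eqh (f_equal (fun W => W ⊗ X) e).
Proof. destruct e; apply tensm_id. Qed.

Lemma tens_mid (W X Y Z : C) : (W ⊗ X) ⊗ (Y ⊗ Z) = W ⊗ ((X ⊗ Y) ⊗ Z).
Proof. now rewrite !tens_assoc. Qed.

End Casts.

Section Dualities.
Context (C : category) (M : strict_monoidal C).
Local Notation "X ⊗ Y" := (tens M X Y) (at level 35, right associativity).
Local Notation "f ⊠ g" := (tensm M f g) (at level 35, right associativity).
Local Notation I := (unit_ob M).
Local Notation assoc := (tens_assoc M).
Local Notation unitl := (tens_unitl M).
Local Notation unitr := (tens_unitr M).

Record is_duality (X X' : C) (d : hom (X' ⊗ X) I) (b : hom I (X ⊗ X')) : Prop := {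
  duality_zigzag :
    eqh (unitr X) ∘ (idm X ⊠ d) ∘ eqh (assoc X X' X)
      ∘ (b ⊠ idm X) ∘ eqh (eq_sym (unitl X)) = idm X;
  duality_zigzag_dual :
    eqh (unitl X') ∘ (d ⊠ idm X') ∘ eqh (eq_sym (assoc X' X X'))
      ∘ (idm X' ⊠ b) ∘ eqh (eq_sym (unitr X')) = idm X'
}.

(* The left dual [f^* : Y^* -> X^*] of [f : X -> Y], which only depends on the
   coevaluation of [X] and the evaluation of [Y]. *)
Definition dual_mor (X X' Y Y' : C) (bX : hom I (X ⊗ X')) (dY : hom (Y' ⊗ Y) I)
    (f : hom X Y) : hom Y' X' :=
  eqh (unitl X') ∘ (dY ⊠ idm X') ∘ eqh (eq_sym (assoc Y' Y X'))
    ∘ (idm Y' ⊠ (f ⊠ idm X')) ∘ (idm Y' ⊠ bX) ∘ eqh (eq_sym (unitr Y')).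

(* [d_{X ⊗ Y}] and [b_{X ⊗ Y}], for [Y' ⊗ X'] as the dual of [X ⊗ Y]. *)
Definition ev_tens (X X' Y Y' : C) (dX : hom (X' ⊗ X) I) (dY : hom (Y' ⊗ Y) I) :
    hom ((Y' ⊗ X') ⊗ (X ⊗ Y)) I :=
  dY ∘ eqh (f_equal (tens M Y') (unitl Y))
     ∘ (idm Y' ⊠ (dX ⊠ idm Y)) ∘ eqh (tens_mid M Y' X' X Y).

Definition coev_tens (X X' Y Y' : C) (bX : hom I (X ⊗ X')) (bY : hom I (Y ⊗ Y')) :
    hom I ((X ⊗ Y) ⊗ (Y' ⊗ X')) :=
  eqh (eq_sym (tens_mid M X Y Y' X')) ∘ (idm X ⊠ (bY ⊠ idm X'))
    ∘ eqh (f_equal (tens M X) (eq_sym (unitl X'))) ∘ bX.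

(* The bijection [Hom(A ⊗ X, I) -> Hom(A, X')] given by the duality. *)
Definition mate (X X' A : C) (b : hom I (X ⊗ X')) (k : hom (A ⊗ X) I) : hom A X' :=
  eqh (unitl X') ∘ (k ⊠ idm X') ∘ eqh (eq_sym (assoc A X X'))
    ∘ (idm A ⊠ b) ∘ eqh (eq_sym (unitr A)).

Lemma whiskr_comp X Y Z W (g : hom Y Z) (f : hom X Y) :
  (g ∘ f) ⊠ idm W = (g ⊠ idm W) ∘ (f ⊠ idm W).
Proof. now rewrite <- tensm_comp, comp_idl. Qed.

Lemma whiskl_comp X Y Z W (g : hom Y Z) (f : hom X Y) :
  idm W ⊠ (g ∘ f) = (idm W ⊠ g) ∘ (idm W ⊠ f).
Proof. now rewrite <- tensm_comp, comp_idl. Qed.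

Lemma interchange X Y Z W (f : hom X Y) (g : hom Z W) :
  (f ⊠ idm W) ∘ (idm X ⊠ g) = (idm Y ⊠ g) ∘ (f ⊠ idm Z).
Proof. now rewrite <- !tensm_comp, !comp_idl, !comp_idr. Qed.

Lemma assoc_nat X X' Y Y' Z Z' (f : hom X X') (g : hom Y Y') (h : hom Z Z')
    (e : (X ⊗ Y) ⊗ Z = X ⊗ (Y ⊗ Z)) (e' : (X' ⊗ Y') ⊗ Z' = X' ⊗ (Y' ⊗ Z')) :
  eqh e' ∘ ((f ⊠ g) ⊠ h) = (f ⊠ (g ⊠ h)) ∘ eqh e.
Proof. apply same_mor_square, tensm_assoc. Qed.

Lemma assoc_nat' X X' Y Y' Z Z' (f : hom X X') (g : hom Y Y') (h : hom Z Z')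
    (e : X ⊗ (Y ⊗ Z) = (X ⊗ Y) ⊗ Z) (e' : X' ⊗ (Y' ⊗ Z') = (X' ⊗ Y') ⊗ Z') :
  eqh e' ∘ (f ⊠ (g ⊠ h)) = ((f ⊠ g) ⊠ h) ∘ eqh e.
Proof. apply same_mor_square, same_mor_sym, tensm_assoc. Qed.

Lemma unitl_nat X Y (f : hom X Y) (e : I ⊗ X = X) (e' : I ⊗ Y = Y) :
  eqh e' ∘ (idm I ⊠ f) = f ∘ eqh e.
Proof. apply same_mor_square, tensm_unitl. Qed.

Lemma unitr_nat X Y (f : hom X Y) (e : X ⊗ I = X) (e' : Y ⊗ I = Y) :
  eqh e' ∘ (f ⊠ idm I) = f ∘ eqh e.
Proof. apply same_mor_square, tensm_unitr. Qed.

Lemma unitr_nat' X Y (f : hom X Y) (e : X = X ⊗ I) (e' : Y = Y ⊗ I) :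
  eqh e' ∘ f = (f ⊠ idm I) ∘ eqh e.
Proof. apply same_mor_square, same_mor_sym, tensm_unitr. Qed.

Lemma dual_mor_mate X X' Y Y' (bX : hom I (X ⊗ X')) (dY : hom (Y' ⊗ Y) I)
    (f : hom X Y) :
  dual_mor bX dY f = mate bX (dY ∘ (idm Y' ⊠ f)).
Proof.
unfold dual_mor, mate.
rewrite whiskr_comp, <- !comp_assoc; do 2 f_equal.
rewrite !comp_assoc; do 2 f_equal.
apply assoc_nat'.
Qed.

Lemma mate_ev X X' A (d : hom (X' ⊗ X) I) (b : hom I (X ⊗ X')) (h : hom A X') :
  is_duality d b -> mate b (d ∘ (h ⊠ idm X)) = h.
Proof.
intros [_ zz]; unfold mate.
rewrite whiskr_comp, <- !comp_assoc.
rewrite (comp_assoc _ (eqh (eq_sym (assoc A X X')))).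
rewrite <- (assoc_nat' h (idm X) (idm X') (eq_sym (assoc A X X'))
  (eq_sym (assoc X' X X'))).
rewrite tensm_id, <- !comp_assoc.
rewrite (comp_assoc (h ⊠ _)), interchange, <- !comp_assoc.
rewrite <- (unitr_nat' h (eq_sym (unitr A)) (eq_sym (unitr X'))).
rewrite !comp_assoc, zz.
apply comp_idl.
Qed.

Lemma ev_mate X X' A (d : hom (X' ⊗ X) I) (b : hom I (X ⊗ X')) (k : hom (A ⊗ X) I) :
  is_duality d b -> d ∘ (mate b k ⊠ idm X) = k.
Proof.
intros [zz _]; unfold mate.
pose (aX := tens_assoc M I X' X).
assert (E1 : d ∘ (eqh (unitl X') ⊠ idm X) = eqh (unitr I) ∘ (idm I ⊠ d) ∘ eqh aX).
{ rewrite (eqh_irr (unitr I) (unitl I)), (unitl_nat d (unitl _)).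
  rewrite <- comp_assoc, eqh_comp, tensm_eqhl; f_equal; apply eqh_irr. }
rewrite !whiskr_comp, !comp_assoc, E1; unfold aX.
rewrite <- (comp_assoc _ (eqh (assoc I X' X))).
rewrite (assoc_nat k (idm X') (idm X) (assoc _ _ _)), tensm_id, !comp_assoc.
rewrite <- (comp_assoc _ (idm I ⊠ d)), <- interchange, comp_assoc.
rewrite (unitr_nat k (unitr _)), <- !comp_assoc.
transitivity (k ∘ idm (A ⊗ X)); [f_equal | apply comp_idr].
assert (E2 : eqh (unitr (A ⊗ X)) ∘ (idm (A ⊗ X) ⊠ d) =
  eqh (f_equal (tens M A) (unitr X)) ∘ (idm A ⊠ (idm X ⊠ d))
    ∘ eqh (assoc A X (X' ⊗ X))).
{ rewrite <- comp_assoc, <- (assoc_nat (idm A) (idm X) d (assoc _ _ _) (assoc _ _ _)).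
  rewrite comp_assoc, eqh_comp, tensm_id; f_equal; apply eqh_irr. }
assert (E3 : (idm A ⊠ b) ⊠ idm X = eqh (eq_sym (assoc A (X ⊗ X') X))
    ∘ (idm A ⊠ (b ⊠ idm X)) ∘ eqh (assoc A I X)).
{ rewrite <- comp_assoc, <- (assoc_nat (idm A) b (idm X) (assoc _ _ _) (assoc _ _ _)).
  now rewrite comp_assoc, eqh_comp, eqh_idm, comp_idl. }
rewrite comp_assoc, E2, E3.
transitivity (idm A ⊠ idm X); [| apply tensm_id].
transitivity (idm A ⊠ (eqh (unitr X) ∘ (idm X ⊠ d) ∘ eqh (assoc X X' X)
  ∘ (b ⊠ idm X) ∘ eqh (eq_sym (unitl X)))); [| now rewrite zz].
rewrite !whiskl_comp, !tensm_eqhr, !tensm_eqhl.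
rewrite <- !comp_assoc; do 2 f_equal.
rewrite eqh_comp, !comp_assoc, !eqh_comp.
f_equal; [f_equal |]; apply eqh_irr.
Qed.

(* [f^*] is the unique [h] such that [d_X (h ⊗ X) = d_Y (Y^* ⊗ f)]. *)
Lemma ev_dual_mor X X' Y Y' (dX : hom (X' ⊗ X) I) (bX : hom I (X ⊗ X'))
    (dY : hom (Y' ⊗ Y) I) (f : hom X Y) :
  is_duality dX bX -> dX ∘ (dual_mor bX dY f ⊠ idm X) = dY ∘ (idm Y' ⊠ f).
Proof. intros H; rewrite dual_mor_mate; now apply ev_mate. Qed.

Lemma dual_mor_unique X X' Y Y' (dX : hom (X' ⊗ X) I) (bX : hom I (X ⊗ X'))
    (dY : hom (Y' ⊗ Y) I) (f : hom X Y) (h : hom Y' X') :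
  is_duality dX bX -> dX ∘ (h ⊠ idm X) = dY ∘ (idm Y' ⊠ f) ->
  dual_mor bX dY f = h.
Proof. intros H E; rewrite dual_mor_mate, <- E; now apply mate_ev. Qed.

Lemma dual_mor_id X X' (d : hom (X' ⊗ X) I) (b : hom I (X ⊗ X')) :
  is_duality d b -> dual_mor b d (idm X) = idm X'.
Proof. intros H; now apply (dual_mor_unique H). Qed.

Lemma dual_mor_comp X X' Y Y' Z Z' (dX : hom (X' ⊗ X) I) (bX : hom I (X ⊗ X'))
    (dY : hom (Y' ⊗ Y) I) (bY : hom I (Y ⊗ Y')) (dZ : hom (Z' ⊗ Z) I)
    (g : hom Y Z) (f : hom X Y) :
  is_duality dX bX -> is_duality dY bY ->
  dual_mor bX dZ (g ∘ f) = dual_mor bX dY f ∘ dual_mor bY dZ g.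
Proof.
intros HX HY; apply (dual_mor_unique HX).
rewrite whiskr_comp, whiskl_comp, !comp_assoc.
rewrite (ev_dual_mor dY f HX), <- comp_assoc, <- interchange, comp_assoc.
now rewrite (ev_dual_mor dZ g HY).
Qed.

End Dualities.

Record left_duality (C : category) (M : strict_monoidal C) := LeftDuality {
  dual : C -> C;
  ev : forall X : C, hom (dual X ⊗[M] X) (unit_ob M);
  coev : forall X : C, hom (unit_ob M) (X ⊗[M] dual X);
  dualP : forall X : C, is_duality (ev X) (coev X)
}.
Arguments dual {C M} D X : rename.
Arguments ev {C M} D X : rename.
Arguments coev {C M} D X : rename.

Section LeftDualityFunctor.
Context (C : category) (M : strict_monoidal C) (D : left_duality M).

Definition dualm (X Y : C) (f : hom X Y) : hom (dual D Y) (dual D X) :=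
  dual_mor (coev D X) (ev D Y) f.

Definition dual_functor : functor (op_category C) C :=
  @Functor (op_category C) C (dual D) (fun Y X f => @dualm X Y f)
    (fun X => dual_mor_id (dualP D X))
    (fun Z Y X f g => dual_mor_comp (ev D Z) g f (dualP D X) (dualP D Y)).

End LeftDualityFunctor.

Arguments dualm {C M} D {X Y} f.

Record strict_pivotal (C : category) (M : strict_monoidal C) := StrictPivotal {
  piv_dual :> left_duality M;
  piv_dual_strict :
    is_strict_monoidal_functor (op_monoidal M) M (dual_functor piv_dual);
  piv_ev_unit : ev piv_dual (unit_ob M) ≡ idm (unit_ob M);
  piv_coev_unit : coev piv_dual (unit_ob M) ≡ idm (unit_ob M);
  piv_ev_tens : forall X Y : C,
    ev piv_dual (X ⊗[M] Y) ≡ ev_tens (ev piv_dual X) (ev piv_dual Y);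
  piv_coev_tens : forall X Y : C,
    coev piv_dual (X ⊗[M] Y) ≡ coev_tens (coev piv_dual X) (coev piv_dual Y);
  (* the functors [(-)^**] and the identity agree on objects and on morphisms *)
  piv_bidual_ob : forall X : C, dual piv_dual (dual piv_dual X) = X;
  piv_bidual_mor : forall (X Y : C) (f : hom X Y),
    dualm piv_dual (dualm piv_dual f) ≡ f
}.

Section PivotalObjects.
Context (C : category) (M : strict_monoidal C).
Local Notation "X ⊗ Y" := (tens M X Y) (at level 35, right associativity).
Local Notation I := (unit_ob M).

(* [(X, X^*, d_X, b_X, d_{X^*}, b_{X^*})], in this order. *)
Record sextuple := Sextuple {
  pob : C;
  pdual : C;
  pev : hom (pdual ⊗ pob) I;
  pcoev : hom I (pob ⊗ pdual);
  pev' : hom (pob ⊗ pdual) I;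
  pcoev' : hom I (pdual ⊗ pob)
}.

Record pivotal_object := PivotalObject {
  psext :> sextuple;
  pdualP : is_duality (pev psext) (pcoev psext);
  pdualP' : is_duality (pev' psext) (pcoev' psext)
}.

Definition pdualm (X Y : sextuple) (f : hom (pob X) (pob Y)) :
    hom (pdual Y) (pdual X) :=
  dual_mor (pcoev X) (pev Y) f.

(* [f^**], with [f^**: X -> Y] formed from the dualities
   [(X^*, X, d_{X^*}, b_{X^*})] and [(Y^*, Y, d_{Y^*}, b_{Y^*})]. *)
Definition pbidualm (X Y : sextuple) (f : hom (pob X) (pob Y)) :
    hom (pob X) (pob Y) :=
  dual_mor (pcoev' Y) (pev' X) (pdualm f).

Record pivotal_hom (X Y : pivotal_object) := PivotalHom {
  pmor :> hom (pob X) (pob Y);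
  pmorP : pmor = pbidualm pmor
}.

Lemma pivotal_hom_eq (X Y : pivotal_object) (f g : pivotal_hom X Y) :
  pmor f = pmor g -> f = g.
Proof.
destruct f as [f fP], g as [g gP]; simpl; intros E; destruct E.
now rewrite (proof_irrelevance _ fP gP).
Qed.

Definition pivotal_id (X : pivotal_object) : pivotal_hom X X.
Proof.
exists (idm (pob X)).
unfold pbidualm, pdualm.
now rewrite (dual_mor_id (pdualP X)), (dual_mor_id (pdualP' X)).
Defined.

Definition pivotal_comp (X Y Z : pivotal_object) (g : pivotal_hom Y Z)
    (f : pivotal_hom X Y) : pivotal_hom X Z.
Proof.
exists (pmor g ∘ pmor f).
unfold pbidualm, pdualm.
rewrite (dual_mor_comp _ _ _ (pdualP X) (pdualP Y)).
rewrite (dual_mor_comp _ _ _ (pdualP' Z) (pdualP' Y)).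
f_equal; apply pmorP.
Defined.

Definition pivotal_category : category.
Proof.
refine (@Category pivotal_object pivotal_hom pivotal_id pivotal_comp _ _ _).
- intros; apply pivotal_hom_eq, comp_idl.
- intros; apply pivotal_hom_eq, comp_idr.
- intros; apply pivotal_hom_eq, comp_assoc.
Defined.

(* [(I, I, id, id, id, id)], using [I ⊗ I = I]. *)
Definition sextuple_unit : sextuple :=
  @Sextuple I I (eqh (tens_unitl M I)) (eqh (eq_sym (tens_unitl M I)))
    (eqh (tens_unitl M I)) (eqh (eq_sym (tens_unitl M I))).

Definition sextuple_tens (X Y : sextuple) : sextuple :=
  @Sextuple (pob X ⊗ pob Y) (pdual Y ⊗ pdual X)
    (ev_tens (pev X) (pev Y)) (coev_tens (pcoev X) (pcoev Y))
    (ev_tens (pev' Y) (pev' X)) (coev_tens (pcoev' Y) (pcoev' X)).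

Definition sextuple_dual (X : sextuple) : sextuple :=
  @Sextuple (pdual X) (pob X) (pev' X) (pcoev' X) (pev X) (pcoev X).

End PivotalObjects.

(* Main.v *)
(* A duality [(X, X', d, b)] makes the endofunctors [X ⊗ -] and [X' ⊗ -] adjoint,
   with counit [d_W : X' ⊗ X ⊗ W -> W] and unit [b_W : W -> X ⊗ X' ⊗ W].  In these
   terms [d_{X ⊗ Y}] and [b_{X ⊗ Y}] are the counit and unit of a composite
   adjunction; associativity, unitality, the zigzag identities of a tensor product,
   and [(f ⊗ g)^* = g^* ⊗ f^*] are then naturality of [d_W] and [b_W].  The
   evaluation [d_X] is a morphism of pivotal objects because [(d_X)^* = b_{X^*}]
   and [(b_X)^* = d_{X^*}], both by a zigzag identity.  A morphism is recovered
   from its whiskerings by taking [W = I]. *)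
From Stdlib Require Import ProofIrrelevance.
Require Import Defs.

Set Implicit Arguments.
Unset Strict Implicit.
Unset Printing Implicit Defensive.

(** * Equality of morphisms across equal objects: congruence and removal of casts *)

Section Heterogeneous.
Context (C : category).
Implicit Types X Y Z : C.

Lemma same_mor_trans X Y X' Y' X'' Y'' (f : hom X Y) (g : hom X' Y')
    (h : hom X'' Y'') : f ≡ g -> g ≡ h -> f ≡ h.
Proof. intros [] []; constructor. Qed.

Lemma same_mor_of_eq X Y (f g : hom X Y) : f = g -> f ≡ g.
Proof. intros []; constructor. Qed.

(** Casts on both sides turn [≡] into an equation of parallel morphisms, so that the object
    equations can be destructed or erased by proof irrelevance. *)
Lemma same_mor_eqh_sides X Y X' Y' (f : hom X Y) (g : hom X' Y') :
  f ≡ g -> exists (eX : X' = X) (eY : Y = Y'), g = eqh eY ∘ f ∘ eqh eX.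
Proof.
intros []; exists eq_refl, eq_refl; simpl.
now rewrite comp_idl, comp_idr.
Qed.

Lemma same_mor_eq X Y (f g : hom X Y) : f ≡ g -> f = g.
Proof.
intros H; destruct (same_mor_eqh_sides H) as (eX & eY & ->).
now rewrite !eqh_idm, comp_idl, comp_idr.
Qed.

Lemma same_mor_castl X Y Z X' Y' (e : Y = Z) (f : hom X Y) (g : hom X' Y') :
  f ≡ g -> eqh e ∘ f ≡ g.
Proof. destruct e; simpl; now rewrite comp_idl. Qed.

Lemma same_mor_castr X Y Z X' Y' (e : Z = X) (f : hom X Y) (g : hom X' Y') :
  f ≡ g -> f ∘ eqh e ≡ g.
Proof. destruct e; simpl; now rewrite comp_idr. Qed.

Lemma same_mor_idm X Y : X = Y -> idm X ≡ idm Y.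
Proof. intros []; constructor. Qed.

Lemma same_mor_eqh X Y Z (e : X = Y) : X = Z -> eqh e ≡ idm Z.
Proof. intros []; destruct e; constructor. Qed.

Lemma same_mor_comp X Y Z X' Y' Z' (g : hom Y Z) (f : hom X Y)
    (g' : hom Y' Z') (f' : hom X' Y') :
  g ≡ g' -> f ≡ f' -> g ∘ f ≡ g' ∘ f'.
Proof.
intros Hg Hf.
destruct (same_mor_eqh_sides Hg) as (eY & eZ & ->).
destruct (same_mor_eqh_sides Hf) as (eX & eY' & ->).
(* [eY] and [eY'] both identify the middle objects; once [eY'] is destructed, [eY] is a loop and its
   cast is an identity. *)
destruct eX, eZ, eY'; simpl; rewrite (eqh_idm eY).
rewrite !comp_idl, !comp_idr; constructor.
Qed.

Lemma same_mor_tensm (M : strict_monoidal C) X Y Z W X' Y' Z' W'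
    (f : hom X Y) (g : hom Z W) (f' : hom X' Y') (g' : hom Z' W') :
  f ≡ f' -> g ≡ g' -> f ⊠[M] g ≡ f' ⊠[M] g'.
Proof. intros [] []; constructor. Qed.

End Heterogeneous.

(** * Evaluations and coevaluations whiskered by an object *)

Section Whiskering.
Context (C : category) (M : strict_monoidal C).
Local Notation "X ⊗ Y" := (tens M X Y) (at level 35, right associativity).
Local Notation "f ⊠ g" := (tensm M f g) (at level 35, right associativity).
Local Notation I := (unit_ob M).

(* [d] and [b] as transformations of the endofunctors [X ⊗ -] and [X' ⊗ -]:
   once every object is nested to the right, no cast is needed. *)
Definition evw (X X' : C) (d : hom (X' ⊗ X) I) (W : C) : hom (X' ⊗ (X ⊗ W)) W :=
  eqh (tens_unitl M W) ∘ (d ⊠ idm W) ∘ eqh (eq_sym (tens_assoc M X' X W)).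

Definition coevw (X X' : C) (b : hom I (X ⊗ X')) (W : C) : hom W (X ⊗ (X' ⊗ W)) :=
  eqh (tens_assoc M X X' W) ∘ (b ⊠ idm W) ∘ eqh (eq_sym (tens_unitl M W)).

Lemma evw_same (X X' : C) (d : hom (X' ⊗ X) I) (W : C) : d ⊠ idm W ≡ evw d W.
Proof.
apply same_mor_sym; unfold evw.
apply same_mor_castr, same_mor_castl; constructor.
Qed.

Lemma coevw_same (X X' : C) (b : hom I (X ⊗ X')) (W : C) : b ⊠ idm W ≡ coevw b W.
Proof.
apply same_mor_sym; unfold coevw.
apply same_mor_castr, same_mor_castl; constructor.
Qed.

(** This is the interchange law for [d] and [h], after rebracketing [idm (X' ⊗ X) ⊠ h]. *)
Lemma evw_nat (X X' : C) (d : hom (X' ⊗ X) I) (A B : C) (h : hom A B) :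
  evw d B ∘ (idm X' ⊠ (idm X ⊠ h)) = h ∘ evw d A.
Proof.
apply same_mor_eq.
apply same_mor_trans with (g := (d ⊠ idm B) ∘ (idm (X' ⊗ X) ⊠ h)).
{ apply same_mor_sym, same_mor_comp; [apply evw_same|].
  rewrite <- tensm_id; apply tensm_assoc. }
rewrite interchange.
apply same_mor_comp; [apply tensm_unitl | apply evw_same].
Qed.

Lemma coevw_nat (X X' : C) (b : hom I (X ⊗ X')) (A B : C) (h : hom A B) :
  (idm X ⊠ (idm X' ⊠ h)) ∘ coevw b A = coevw b B ∘ h.
Proof.
apply same_mor_eq.
apply same_mor_trans with (g := (idm (X ⊗ X') ⊠ h) ∘ (b ⊠ idm A)).
{ apply same_mor_sym, same_mor_comp; [|apply coevw_same].
  rewrite <- tensm_id; apply tensm_assoc. }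
rewrite <- interchange.
apply same_mor_comp; [apply coevw_same | apply tensm_unitl].
Qed.

Lemma same_mor_whiskr_unit (X Y X' Y' : C) (f : hom X Y) (f' : hom X' Y') :
  f ⊠ idm I ≡ f' ⊠ idm I -> f ≡ f'.
Proof.
intros H; eapply same_mor_trans; [apply same_mor_sym, (tensm_unitr M)|].
eapply same_mor_trans; [apply H | apply (tensm_unitr M)].
Qed.

Lemma whiskr_eqh (X Y W : C) (e : X = Y) : eqh e ⊠ idm W ≡ idm (X ⊗ W).
Proof. destruct e; simpl; apply same_mor_of_eq, tensm_id. Qed.

Lemma same_mor_whiskr_castl (X Y Z W A B : C) (e : Y = Z) (f : hom X Y) (g : hom A B) :
  f ⊠ idm W ≡ g -> (eqh e ∘ f) ⊠ idm W ≡ g.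
Proof. destruct e; simpl; now rewrite comp_idl. Qed.

Lemma same_mor_whiskr_castr (X Y Z W A B : C) (e : Z = X) (f : hom X Y) (g : hom A B) :
  f ⊠ idm W ≡ g -> (f ∘ eqh e) ⊠ idm W ≡ g.
Proof. destruct e; simpl; now rewrite comp_idr. Qed.

Lemma same_mor_whiskr_comp (X Y Z W A B D : C) (g : hom Y Z) (f : hom X Y)
    (g' : hom B D) (f' : hom A B) :
  g ⊠ idm W ≡ g' -> f ⊠ idm W ≡ f' -> (g ∘ f) ⊠ idm W ≡ g' ∘ f'.
Proof. rewrite whiskr_comp; apply same_mor_comp. Qed.

Lemma same_mor_whiskr_tensm (X X' Y Y' W A B A' B' : C) (f : hom X X') (g : hom Y Y')
    (f' : hom A A') (g' : hom B B') :
  f ≡ f' -> g ⊠ idm W ≡ g' -> (f ⊠ g) ⊠ idm W ≡ f' ⊠ g'.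
Proof.
intros Hf Hg; eapply same_mor_trans; [apply tensm_assoc|].
now apply same_mor_tensm.
Qed.

End Whiskering.

(* Pushes [- ⊠ idm W] to the leaves, nesting to the right and dropping casts. *)
Ltac whisk :=
  lazymatch goal with
  | |- eqh _ ∘ _ ≡ _ => apply same_mor_castl; whisk
  | |- _ ∘ eqh _ ≡ _ => apply same_mor_castr; whisk
  | |- _ ∘ _ ≡ _ => eapply same_mor_comp; whisk
  | |- (eqh _ ∘ _) ⊠[_] idm _ ≡ _ => apply same_mor_whiskr_castl; whisk
  | |- (_ ∘ eqh _) ⊠[_] idm _ ≡ _ => apply same_mor_whiskr_castr; whisk
  | |- (_ ∘ _) ⊠[_] idm _ ≡ _ => eapply same_mor_whiskr_comp; whisk
  (* Two nested identity whiskerings merge into one, so that [d] or [b] ends as a single [evw] or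
     [coevw]. This case comes before the general tensor case, which would leave the left factor
     untouched. *)
  | |- (_ ⊠[_] idm _) ⊠[_] idm _ ≡ _ =>
     eapply same_mor_trans; [apply tensm_assoc|]; rewrite tensm_id; whisk
  | |- (_ ⊠[_] _) ⊠[_] idm _ ≡ _ => eapply same_mor_whiskr_tensm; [constructor|whisk]
  | |- ?f ⊠[?M] idm _ ≡ _ =>
     lazymatch type of f with
     | hom (tens _ _ _) (unit_ob _) => apply evw_same
     | hom (unit_ob _) (tens _ _ _) => apply coevw_same
     | _ => constructor
     end
  end.

(** * Zigzags, tensor products of dualities, and duals of morphisms in whiskered form *)

Section Dualities.
Context (C : category) (M : strict_monoidal C).
Local Notation "X ⊗ Y" := (tens M X Y) (at level 35, right associativity).
Local Notation "f ⊠ g" := (tensm M f g) (at level 35, right associativity).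
Local Notation I := (unit_ob M).

Lemma zigzag_w (X X' : C) (d : hom (X' ⊗ X) I) (b : hom I (X ⊗ X')) :
  is_duality d b -> forall W : C,
  (idm X ⊠ evw d W) ∘ coevw b (X ⊗ W) = idm (X ⊗ W).
Proof.
intros [zz _] W; apply same_mor_eq, same_mor_sym.
apply (f_equal (fun k => k ⊠ idm W)) in zz; rewrite tensm_id in zz.
rewrite <- zz; whisk.
Qed.

Lemma zigzag_dual_w (X X' : C) (d : hom (X' ⊗ X) I) (b : hom I (X ⊗ X')) :
  is_duality d b -> forall W : C,
  evw d (X' ⊗ W) ∘ (idm X' ⊠ coevw b W) = idm (X' ⊗ W).
Proof.
intros [_ zz] W; apply same_mor_eq, same_mor_sym.
apply (f_equal (fun k => k ⊠ idm W)) in zz; rewrite tensm_id in zz.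
rewrite <- zz; whisk.
Qed.

(** Whiskering by [I] loses nothing, so the two triangle identities at this one object suffice. *)
Lemma is_duality_intro (X X' : C) (d : hom (X' ⊗ X) I) (b : hom I (X ⊗ X')) :
  (idm X ⊠ evw d I) ∘ coevw b (X ⊗ I) = idm (X ⊗ I) ->
  evw d (X' ⊗ I) ∘ (idm X' ⊠ coevw b I) = idm (X' ⊗ I) ->
  is_duality d b.
Proof.
intros z1 z2; split; apply same_mor_eq, (@same_mor_whiskr_unit _ M);
  rewrite tensm_id, <- ?z1, <- ?z2; whisk.
Qed.

(** The inner pair [X' ⊗ X] is cancelled first, then [Y' ⊗ Y]. The hypothesis [V = W] lets the
    whiskering object be rebracketed on the way. *)
Lemma evw_tens (X X' Y Y' : C) (dX : hom (X' ⊗ X) I) (dY : hom (Y' ⊗ Y) I) (V W : C) :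
  V = W -> evw (ev_tens dX dY) V ≡ evw dY W ∘ (idm Y' ⊠ evw dX (Y ⊗ W)).
Proof.
intros []; eapply same_mor_trans; [apply same_mor_sym, evw_same|].
unfold ev_tens; whisk.
Qed.

Lemma coevw_tens (X X' Y Y' : C) (bX : hom I (X ⊗ X')) (bY : hom I (Y ⊗ Y')) (V W : C) :
  V = W -> coevw (coev_tens bX bY) V ≡ (idm X ⊠ coevw bY (X' ⊗ W)) ∘ coevw bX W.
Proof.
intros []; eapply same_mor_trans; [apply same_mor_sym, coevw_same|].
unfold coev_tens; whisk.
Qed.

Lemma evw_congr (X X' : C) (d : hom (X' ⊗ X) I) (V W : C) :
  V = W -> evw d V ≡ evw d W.
Proof. intros []; constructor. Qed.

Lemma coevw_congr (X X' : C) (b : hom I (X ⊗ X')) (V W : C) :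
  V = W -> coevw b V ≡ coevw b W.
Proof. intros []; constructor. Qed.

Lemma same_mor_comp_idm_l (X Y A B Z : C) (k : hom Y Z) (f : hom X Y) (g : hom A B) :
  k ≡ idm Z -> f ≡ g -> k ∘ f ≡ g.
Proof.
intros Hk Hf; destruct (same_mor_eqh_sides Hk) as (e & e' & E).
destruct e; rewrite eqh_idm in E; simpl in E; rewrite comp_idl, comp_idr in E.
now rewrite <- E, comp_idl.
Qed.

Lemma whiskl_tens (X Y A B A' B' : C) (f : hom A B) (f' : hom A' B') :
  f ≡ f' -> idm (X ⊗ Y) ⊠ f ≡ idm X ⊠ (idm Y ⊠ f').
Proof. intros []; rewrite <- tensm_id; apply tensm_assoc. Qed.

(** Tensoring with [I] is the identity endofunctor, so its counit is trivial; this is what makes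
    [sextuple_unit] a strict unit. *)
Lemma evw_unit (V W : C) : V = W -> evw (eqh (tens_unitl M I)) V ≡ idm W.
Proof.
intros []; unfold evw; apply same_mor_castr, same_mor_castl.
eapply same_mor_trans; [apply whiskr_eqh|].
apply same_mor_idm; now rewrite !tens_unitl.
Qed.

Lemma coevw_unit (V W : C) :
  V = W -> coevw (eqh (eq_sym (tens_unitl M I))) V ≡ idm W.
Proof.
intros []; unfold coevw; apply same_mor_castr, same_mor_castl.
eapply same_mor_trans; [apply whiskr_eqh|].
apply same_mor_idm, tens_unitl.
Qed.

Lemma dual_mor_w (X X' Y Y' : C) (bX : hom I (X ⊗ X')) (dY : hom (Y' ⊗ Y) I)
    (f : hom X Y) (W : C) :
  dual_mor bX dY f ⊠ idm W =
  evw dY (X' ⊗ W) ∘ (idm Y' ⊠ (f ⊠ idm (X' ⊗ W))) ∘ (idm Y' ⊠ coevw bX W).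
Proof. apply same_mor_eq; unfold dual_mor; whisk. Qed.

Lemma is_duality_unit :
  is_duality (eqh (tens_unitl M I)) (eqh (eq_sym (tens_unitl M I))).
Proof.
split; rewrite !tensm_eqhr, !tensm_eqhl, !eqh_comp; apply eqh_idm.
Qed.

Lemma is_duality_tens (X X' Y Y' : C) (dX : hom (X' ⊗ X) I) (bX : hom I (X ⊗ X'))
    (dY : hom (Y' ⊗ Y) I) (bY : hom I (Y ⊗ Y')) :
  is_duality dX bX -> is_duality dY bY ->
  is_duality (ev_tens dX dY) (coev_tens bX bY).
Proof.
intros HX HY; apply is_duality_intro; apply same_mor_eq.
- apply same_mor_trans with
    (g := (idm X ⊠ (idm Y ⊠ (evw dY I ∘ (idm Y' ⊠ evw dX (Y ⊗ I)))))
      ∘ ((idm X ⊠ coevw bY (X' ⊗ X ⊗ Y ⊗ I)) ∘ coevw bX (X ⊗ Y ⊗ I))).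
  { apply same_mor_comp; [apply whiskl_tens, evw_tens | apply coevw_tens];
      auto using tens_assoc. }
  rewrite comp_assoc, <- whiskl_comp, (whiskl_comp M Y (evw dY I)).
  (* Naturality lets [evw dX] act before [coevw bY], which leaves the zigzag of [Y] nested inside
     that of [X]. *)
  rewrite <- (comp_assoc (idm Y ⊠ evw dY I)), coevw_nat, comp_assoc.
  rewrite (zigzag_w HY), comp_idl, (zigzag_w HX).
  apply same_mor_idm; symmetry; apply tens_assoc.
- apply same_mor_trans with
    (g := (evw dY (Y' ⊗ X' ⊗ I) ∘ (idm Y' ⊠ evw dX (Y ⊗ Y' ⊗ X' ⊗ I)))
      ∘ (idm Y' ⊠ (idm X' ⊠ ((idm X ⊠ coevw bY (X' ⊗ I)) ∘ coevw bX I)))).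
  { apply same_mor_comp; [apply evw_tens | apply whiskl_tens, coevw_tens];
      auto using tens_assoc. }
  rewrite <- comp_assoc, <- whiskl_comp, (whiskl_comp M X' (idm X ⊠ _)).
  (* Naturality lets [evw dX] act before [coevw bY]; the dual zigzag of [X] is now exposed, and that
     of [Y] remains after it. *)
  rewrite (comp_assoc (evw dX _)), evw_nat, <- comp_assoc.
  rewrite (zigzag_dual_w HX), comp_idr, (zigzag_dual_w HY).
  apply same_mor_idm; symmetry; apply tens_assoc.
Qed.

Lemma ev_tens_assoc (X X' Y Y' Z Z' : C) (dX : hom (X' ⊗ X) I)
    (dY : hom (Y' ⊗ Y) I) (dZ : hom (Z' ⊗ Z) I) :
  ev_tens (ev_tens dX dY) dZ ≡ ev_tens dX (ev_tens dY dZ).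
Proof.
apply (@same_mor_whiskr_unit _ M).
(* Both bracketings cancel the three pairs from the inside out: [X], then [Y], then [Z]. *)
apply same_mor_trans with
  (g := evw dZ I ∘ (idm Z' ⊠ (evw dY (Z ⊗ I) ∘ (idm Y' ⊠ evw dX (Y ⊗ Z ⊗ I))))).
- eapply same_mor_trans; [apply evw_same|].
  eapply same_mor_trans; [now apply evw_tens|].
  apply same_mor_comp; [constructor|].
  apply same_mor_tensm; [constructor|].
  now apply evw_tens.
- apply same_mor_sym.
  eapply same_mor_trans; [apply evw_same|].
  eapply same_mor_trans; [now apply evw_tens|].
  rewrite whiskl_comp, comp_assoc.
  apply same_mor_comp; [now apply evw_tens|].
  apply whiskl_tens, evw_congr, tens_assoc.
Qed.

Lemma coev_tens_assoc (X X' Y Y' Z Z' : C) (bX : hom I (X ⊗ X'))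
    (bY : hom I (Y ⊗ Y')) (bZ : hom I (Z ⊗ Z')) :
  coev_tens (coev_tens bX bY) bZ ≡ coev_tens bX (coev_tens bY bZ).
Proof.
apply (@same_mor_whiskr_unit _ M).
apply same_mor_trans with
  (g := (idm X ⊠ ((idm Y ⊠ coevw bZ (Y' ⊗ X' ⊗ I)) ∘ coevw bY (X' ⊗ I)))
     ∘ coevw bX I).
- eapply same_mor_trans; [apply coevw_same|].
  eapply same_mor_trans; [now apply coevw_tens|].
  rewrite whiskl_comp, <- comp_assoc.
  apply same_mor_comp; [|now apply coevw_tens].
  apply whiskl_tens, coevw_congr, tens_assoc.
- apply same_mor_sym.
  eapply same_mor_trans; [apply coevw_same|].
  eapply same_mor_trans; [now apply coevw_tens|].
  apply same_mor_comp; [|constructor].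
  apply same_mor_tensm; [constructor|].
  now apply coevw_tens.
Qed.

Lemma ev_tens_unitl (X X' : C) (d : hom (X' ⊗ X) I) :
  ev_tens (eqh (tens_unitl M I)) d ≡ d.
Proof.
apply (@same_mor_whiskr_unit _ M).
eapply same_mor_trans; [apply evw_same|].
eapply same_mor_trans; [now apply evw_tens|].
rewrite <- (comp_idr (d ⊠ idm I)).
apply same_mor_comp; [apply same_mor_sym, evw_same|].
rewrite <- !tensm_id.
eapply same_mor_trans; [|apply same_mor_sym, tensm_assoc].
apply same_mor_tensm; [constructor|].
rewrite tensm_id; now apply evw_unit.
Qed.

Lemma ev_tens_unitr (X X' : C) (d : hom (X' ⊗ X) I) :
  ev_tens d (eqh (tens_unitl M I)) ≡ d.
Proof.
apply (@same_mor_whiskr_unit _ M).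
eapply same_mor_trans; [apply evw_same|].
eapply same_mor_trans; [now apply evw_tens|].
rewrite <- (comp_idl (d ⊠ idm I)).
apply same_mor_comp.
- apply evw_unit; symmetry; apply tens_unitl.
- eapply same_mor_trans; [apply tensm_unitl|].
  eapply same_mor_trans; [apply evw_congr, tens_unitl | apply same_mor_sym, evw_same].
Qed.

Lemma coev_tens_unitl (X X' : C) (b : hom I (X ⊗ X')) :
  coev_tens (eqh (eq_sym (tens_unitl M I))) b ≡ b.
Proof.
apply (@same_mor_whiskr_unit _ M).
eapply same_mor_trans; [apply coevw_same|].
eapply same_mor_trans; [now apply coevw_tens|].
rewrite <- (comp_idr (b ⊠ idm I)).
apply same_mor_comp.
- eapply same_mor_trans; [apply tensm_unitl|].
  eapply same_mor_trans; [apply coevw_congr, tens_unitl | apply same_mor_sym, coevw_same].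
- apply coevw_unit; symmetry; apply tens_unitl.
Qed.

Lemma coev_tens_unitr (X X' : C) (b : hom I (X ⊗ X')) :
  coev_tens b (eqh (eq_sym (tens_unitl M I))) ≡ b.
Proof.
apply (@same_mor_whiskr_unit _ M).
eapply same_mor_trans; [apply coevw_same|].
eapply same_mor_trans; [now apply coevw_tens|].
rewrite <- (comp_idl (b ⊠ idm I)).
apply same_mor_comp; [|apply same_mor_sym, coevw_same].
rewrite <- !tensm_id.
eapply same_mor_trans; [|apply same_mor_sym, tensm_assoc].
apply same_mor_tensm; [constructor|].
rewrite tensm_id; now apply coevw_unit.
Qed.

Lemma dual_mor_tens (X X' Y Y' Z Z' W W' : C) (bX : hom I (X ⊗ X'))
    (dY : hom (Y' ⊗ Y) I) (bZ : hom I (Z ⊗ Z')) (dW : hom (W' ⊗ W) I)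
    (f : hom X Y) (g : hom Z W) :
  dual_mor (coev_tens bX bZ) (ev_tens dY dW) (f ⊠ g) =
  dual_mor bZ dW g ⊠ dual_mor bX dY f.
Proof.
apply same_mor_eq, (@same_mor_whiskr_unit _ M).
rewrite dual_mor_w, <- comp_assoc, <- whiskl_comp.
apply same_mor_trans with
  (g := (evw dW (Z' ⊗ X' ⊗ I) ∘ (idm W' ⊠ evw dY (W ⊗ Z' ⊗ X' ⊗ I)))
    ∘ (idm W' ⊠ (idm Y' ⊠ ((f ⊠ (g ⊠ idm (Z' ⊗ X' ⊗ I)))
         ∘ ((idm X ⊠ coevw bZ (X' ⊗ I)) ∘ coevw bX I))))).
{ apply same_mor_comp; [now apply evw_tens, tens_assoc | apply whiskl_tens].
  apply same_mor_comp; [|now apply coevw_tens].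
  eapply same_mor_trans; [apply tensm_assoc|].
  apply same_mor_tensm; [constructor|].
  apply same_mor_tensm; [constructor|].
  apply same_mor_idm, tens_assoc. }
apply same_mor_sym; eapply same_mor_trans; [apply tensm_assoc|].
(* The inserted identities make [f^*] act first and [g^*] second, each whiskered on the right by an
   identity, as [dual_mor_w] requires. *)
rewrite <- (comp_idl (dual_mor bX dY f ⊠ idm I)), <- (comp_idr (dual_mor bZ dW g)).
rewrite tensm_comp, !dual_mor_w.
apply same_mor_of_eq.
rewrite <- !comp_assoc, <- !whiskl_comp; do 2 f_equal.
(* [k] is the part of [g^*] that precedes its evaluation. Since [f ⊠ k] is [f] followed by [k],
   naturality of [evw dY] slides [k] out of [f^*]. *)
set (k := (g ⊠ idm (Z' ⊗ X' ⊗ I)) ∘ coevw bZ (X' ⊗ I)).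
rewrite (comp_assoc (f ⊠ _)), <- tensm_comp, comp_idr.
fold k.
replace (f ⊠ k) with ((idm Y ⊠ k) ∘ (f ⊠ idm (X' ⊗ I)))
  by (now rewrite <- tensm_comp, comp_idl, comp_idr).
rewrite <- comp_assoc, (whiskl_comp M Y' (idm Y ⊠ k)), (comp_assoc (evw dY _)), evw_nat.
unfold k; now rewrite <- !comp_assoc.
Qed.

(** After [b'] creates [X' ⊗ X], [b] inserts a pair between the two factors and [d] cancels the left
    half: a dual zigzag, leaving [b']. With [b'] the coevaluation of [X^*] this is
    [(d_X)^* = b_{X^*}]. *)
Lemma dual_mor_ev (X X' : C) (d : hom (X' ⊗ X) I) (b : hom I (X ⊗ X'))
    (b' : hom I (X' ⊗ X)) :
  is_duality d b ->
  dual_mor (coev_tens b' b) (eqh (tens_unitl M I)) d = b'.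
Proof.
intros H; apply same_mor_eq, (@same_mor_whiskr_unit _ M).
rewrite dual_mor_w, <- comp_assoc, <- whiskl_comp.
apply same_mor_comp_idm_l.
{ now apply evw_unit. }
eapply same_mor_trans; [apply tensm_unitl|].
apply same_mor_trans with
  (g := evw d (X' ⊗ X ⊗ I) ∘ ((idm X' ⊠ coevw b (X ⊗ I)) ∘ coevw b' I)).
{ apply same_mor_comp; [|now apply coevw_tens].
  eapply same_mor_trans; [apply evw_same | apply evw_congr, tens_assoc]. }
rewrite comp_assoc, (zigzag_dual_w H), comp_idl.
apply same_mor_sym, coevw_same.
Qed.

(** Here [b] creates a pair to the right of [X ⊗ X'], [d] cancels the middle [X' ⊗ X], and [d']
    evaluates what remains. *)
Lemma dual_mor_coev (X X' : C) (d : hom (X' ⊗ X) I) (b : hom I (X ⊗ X'))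
    (d' : hom (X ⊗ X') I) :
  is_duality d b ->
  dual_mor (eqh (eq_sym (tens_unitl M I))) (ev_tens d d') b = d'.
Proof.
intros H; apply same_mor_eq, (@same_mor_whiskr_unit _ M).
rewrite dual_mor_w.
apply same_mor_trans with
  (g := (evw d' I ∘ (idm X ⊠ evw d (X' ⊗ I)) ∘ (idm X ⊠ (idm X' ⊠ coevw b I)))
    ∘ idm _).
{ apply same_mor_comp; [apply same_mor_comp|].
  - apply evw_tens, tens_unitl.
  - apply whiskl_tens.
    eapply same_mor_trans; [apply coevw_same | apply coevw_congr, tens_unitl].
  - eapply same_mor_trans; [eapply same_mor_tensm; [constructor | now apply coevw_unit]|].
    rewrite tensm_id; apply same_mor_idm, tens_assoc. }
rewrite comp_idr, <- comp_assoc, <- whiskl_comp, (zigzag_dual_w H), tensm_id, comp_idr.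
apply same_mor_sym, evw_same.
Qed.

End Dualities.

(** * The strict pivotal structure on [pivotal_category M] *)

Section PivotalCategory.
Context (C : category) (M : strict_monoidal C).
Local Notation I := (unit_ob M).

Lemma sextuple_ext (X Y : sextuple M) :
  pob X = pob Y -> pdual X = pdual Y -> pev X ≡ pev Y -> pcoev X ≡ pcoev Y ->
  pev' X ≡ pev' Y -> pcoev' X ≡ pcoev' Y -> X = Y.
Proof.
destruct X as [X X' d b d' b'], Y as [Y Y' e c e' c']; simpl.
intros EX EX' H1 H2 H3 H4; subst Y Y'.
f_equal; now apply same_mor_eq.
Qed.

Lemma pivotal_object_ext (X Y : pivotal_object M) : psext X = psext Y -> X = Y.
Proof.
destruct X as [X HX HX'], Y as [Y HY HY']; simpl; intros E; destruct E.
now rewrite (proof_irrelevance _ HX HY), (proof_irrelevance _ HX' HY').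
Qed.

(** Proof components being irrelevant, an object is its sextuple and a morphism its underlying
    morphism; equations in [pivotal_category M] thus reduce to [C]. *)
Lemma pivotal_same_mor (X Y X' Y' : pivotal_category M) (f : hom X Y) (g : hom X' Y') :
  psext X = psext X' -> psext Y = psext Y' -> pmor f ≡ pmor g -> f ≡ g.
Proof.
intros EX%pivotal_object_ext EY%pivotal_object_ext H; destruct EX, EY.
apply same_mor_of_eq, pivotal_hom_eq, same_mor_eq, H.
Qed.

(** This carries formulas written with [eqh] along the forgetful functor. *)
Lemma pmor_eqh (X Y : pivotal_category M) (e : X = Y) :
  pmor (eqh e) = eqh (f_equal (fun Z : pivotal_object M => pob Z) e).
Proof. destruct e; reflexivity. Qed.

Definition pivotal_unit : pivotal_object M :=
  @PivotalObject C M (sextuple_unit M) (is_duality_unit M) (is_duality_unit M).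

Definition pivotal_tens (X Y : pivotal_object M) : pivotal_object M :=
  @PivotalObject C M (sextuple_tens X Y)
    (is_duality_tens (pdualP X) (pdualP Y)) (is_duality_tens (pdualP' Y) (pdualP' X)).

Definition pivotal_dual (X : pivotal_object M) : pivotal_object M :=
  @PivotalObject C M (sextuple_dual X) (pdualP' X) (pdualP X).

(** The double dual reverses the two factors twice, so it is [f^** ⊠ g^**]. *)
Lemma pbidualm_tens (X X' Y Y' : pivotal_object M)
    (f : pivotal_hom X X') (g : pivotal_hom Y Y') :
  f ⊠[M] g = @pbidualm C M (pivotal_tens X Y) (pivotal_tens X' Y') (f ⊠[M] g).
Proof.
unfold pbidualm, pdualm; simpl.
rewrite !dual_mor_tens; f_equal; apply pmorP.
Qed.

Definition pivotal_tensm (X X' Y Y' : pivotal_object M)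
    (f : pivotal_hom X X') (g : pivotal_hom Y Y') :
    pivotal_hom (pivotal_tens X Y) (pivotal_tens X' Y') :=
  @PivotalHom C M (pivotal_tens X Y) (pivotal_tens X' Y') (f ⊠[M] g)
    (pbidualm_tens f g).

Lemma sextuple_tens_assoc (X Y Z : sextuple M) :
  sextuple_tens (sextuple_tens X Y) Z = sextuple_tens X (sextuple_tens Y Z).
Proof.
apply sextuple_ext; simpl.
- apply tens_assoc.
- symmetry; apply tens_assoc.
- apply ev_tens_assoc.
- apply coev_tens_assoc.
- apply same_mor_sym, ev_tens_assoc.
- apply same_mor_sym, coev_tens_assoc.
Qed.

Lemma sextuple_tens_unitl (X : sextuple M) : sextuple_tens (sextuple_unit M) X = X.
Proof.
apply sextuple_ext; simpl.
- apply tens_unitl.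
- apply tens_unitr.
- apply ev_tens_unitl.
- apply coev_tens_unitl.
- apply ev_tens_unitr.
- apply coev_tens_unitr.
Qed.

Lemma sextuple_tens_unitr (X : sextuple M) : sextuple_tens X (sextuple_unit M) = X.
Proof.
apply sextuple_ext; simpl.
- apply tens_unitr.
- apply tens_unitl.
- apply ev_tens_unitr.
- apply coev_tens_unitr.
- apply ev_tens_unitl.
- apply coev_tens_unitl.
Qed.

(** Kept transparent, so that its unit and tensor products reduce to their sextuples and underlying
    morphisms below. *)
Definition pivotal_monoidal : strict_monoidal (pivotal_category M).
Proof.
refine (@StrictMonoidal (pivotal_category M) pivotal_unit pivotal_tens pivotal_tensm
  _ _ _ _ _ _ _ _).
- intros; apply pivotal_hom_eq, tensm_id.
- intros; apply pivotal_hom_eq, tensm_comp.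
- intros; apply pivotal_object_ext, sextuple_tens_assoc.
- intros; apply pivotal_object_ext, sextuple_tens_unitl.
- intros; apply pivotal_object_ext, sextuple_tens_unitr.
- intros; apply pivotal_same_mor; [apply sextuple_tens_assoc.. | apply tensm_assoc].
- intros; apply pivotal_same_mor; [apply sextuple_tens_unitl.. | apply tensm_unitl].
- intros; apply pivotal_same_mor; [apply sextuple_tens_unitr.. | apply tensm_unitr].
Defined.

(** The first duality of [X] gives [(d_X)^* = b_{X^*}], and the second one gives
    [(b_{X^*})^* = d_X]. *)
Lemma pbidualm_ev (X : pivotal_object M) :
  pev X = @pbidualm C M (pivotal_tens (pivotal_dual X) X) pivotal_unit (pev X).
Proof.
unfold pbidualm, pdualm; simpl.
now rewrite (dual_mor_ev _ (pdualP X)), (dual_mor_coev _ (pdualP' X)).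
Qed.

Lemma pbidualm_coev (X : pivotal_object M) :
  pcoev X = @pbidualm C M pivotal_unit (pivotal_tens X (pivotal_dual X)) (pcoev X).
Proof.
unfold pbidualm, pdualm; simpl.
now rewrite (dual_mor_coev _ (pdualP X)), (dual_mor_ev _ (pdualP' X)).
Qed.

Definition pivotal_ev (X : pivotal_object M) :
    pivotal_hom (pivotal_tens (pivotal_dual X) X) pivotal_unit :=
  @PivotalHom C M (pivotal_tens (pivotal_dual X) X) pivotal_unit (pev X) (pbidualm_ev X).

Definition pivotal_coev (X : pivotal_object M) :
    pivotal_hom pivotal_unit (pivotal_tens X (pivotal_dual X)) :=
  @PivotalHom C M pivotal_unit (pivotal_tens X (pivotal_dual X)) (pcoev X)
    (pbidualm_coev X).

Lemma pivotal_dualP (X : pivotal_object M) :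
  @is_duality (pivotal_category M) pivotal_monoidal X (pivotal_dual X)
    (pivotal_ev X) (pivotal_coev X).
Proof.
destruct (pdualP X) as [z1 z2].
split; apply pivotal_hom_eq;
  [eapply eq_trans; [|exact z1] | eapply eq_trans; [|exact z2]];
  cbn [comp pivotal_category pivotal_comp pmor]; rewrite !pmor_eqh;
  (* The underlying zigzags differ from [z1] and [z2] only in the equality proofs inside [eqh]. *)
  simpl; repeat first [apply eqh_irr | f_equal].
Qed.

Definition pivotal_left_duality : left_duality pivotal_monoidal :=
  @LeftDuality _ pivotal_monoidal pivotal_dual pivotal_ev pivotal_coev pivotal_dualP.

(** The forgetful functor preserves composition, tensor products, evaluations and coevaluations,
    hence the formula for the dual. *)
Lemma pmor_dualm (X Y : pivotal_category M) (f : hom X Y) :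
  pmor (dualm pivotal_left_duality f) =
  dual_mor (pcoev (psext X)) (pev (psext Y)) (pmor f).
Proof.
unfold dualm, dual_mor.
cbn [comp pivotal_category pivotal_comp pmor]; rewrite !pmor_eqh.
simpl; repeat first [apply eqh_irr | f_equal].
Qed.

Lemma pmor_ev_tens (X X' Y Y' : pivotal_category M)
    (dX : hom (tens pivotal_monoidal X' X) (unit_ob pivotal_monoidal))
    (dY : hom (tens pivotal_monoidal Y' Y) (unit_ob pivotal_monoidal)) :
  pmor (ev_tens dX dY) =
  @ev_tens C M (pob X) (pob X') (pob Y) (pob Y') (pmor dX) (pmor dY).
Proof.
unfold ev_tens.
cbn [comp pivotal_category pivotal_comp pmor]; rewrite !pmor_eqh.
simpl; repeat first [apply eqh_irr | f_equal].
Qed.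

Lemma pmor_coev_tens (X X' Y Y' : pivotal_category M)
    (bX : hom (unit_ob pivotal_monoidal) (tens pivotal_monoidal X X'))
    (bY : hom (unit_ob pivotal_monoidal) (tens pivotal_monoidal Y Y')) :
  pmor (coev_tens bX bY) =
  @coev_tens C M (pob X) (pob X') (pob Y) (pob Y') (pmor bX) (pmor bY).
Proof.
unfold coev_tens.
cbn [comp pivotal_category pivotal_comp pmor]; rewrite !pmor_eqh.
simpl; repeat first [apply eqh_irr | f_equal].
Qed.

Definition pivotal_structure : strict_pivotal pivotal_monoidal.
Proof.
refine (@StrictPivotal _ pivotal_monoidal pivotal_left_duality _ _ _ _ _ _ _).
- split.
  + apply pivotal_object_ext; reflexivity.
  + intros; apply pivotal_object_ext; reflexivity.
  + intros X X' Y Y' f g.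
    apply pivotal_same_mor; [reflexivity.. |].
    apply same_mor_of_eq.
    (* The product of [f] and [g] in the opposite category is [g ⊠ f], and dualizing reverses it
       back. *)
    change (pmor (dualm pivotal_left_duality (@tensm _ pivotal_monoidal Y' Y X' X g f)) =
      pmor (@dualm _ _ pivotal_left_duality X' X f) ⊠[M]
      pmor (@dualm _ _ pivotal_left_duality Y' Y g)).
    rewrite !pmor_dualm; apply dual_mor_tens.
(* The evaluation of the unit is the cast along [I ⊗ I = I], which [≡] identifies with the
   identity. *)
- apply pivotal_same_mor; [apply sextuple_tens_unitl | reflexivity |].
  apply same_mor_eqh; simpl; apply tens_unitl.
- apply pivotal_same_mor; [reflexivity | apply sextuple_tens_unitl |].
  apply same_mor_eqh; reflexivity.
- intros X Y; apply pivotal_same_mor; [reflexivity.. |].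
  rewrite pmor_ev_tens; constructor.
- intros X Y; apply pivotal_same_mor; [reflexivity.. |].
  rewrite pmor_coev_tens; constructor.
- intros X; apply pivotal_object_ext; now destruct X as [[]].
- intros X Y f; apply pivotal_same_mor;
    [now destruct X as [[]] | now destruct Y as [[]] |].
  (* What remains is [f^** = f], the condition defining morphisms of pivotal objects. *)
  rewrite !pmor_dualm; apply same_mor_of_eq; symmetry; apply pmorP.
Defined.

End PivotalCategory.

Theorem proposition3p2 (C : category) (M : strict_monoidal C) :
  exists (T : strict_monoidal (pivotal_category M)) (P : strict_pivotal T),
    psext (unit_ob T) = sextuple_unit M /\
    (forall X Y : pivotal_category M,
       psext (X ⊗[T] Y) = sextuple_tens (psext X) (psext Y)) /\
    (forall (X X' Y Y' : pivotal_category M) (f : hom X X') (g : hom Y Y'),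
       pmor (f ⊠[T] g) ≡ pmor f ⊠[M] pmor g) /\
    (forall X : pivotal_category M,
       psext (dual P X) = sextuple_dual (psext X)) /\
    (forall X : pivotal_category M,
       pmor (ev P X) ≡ pev (psext X) /\
       pmor (coev P X) ≡ pcoev (psext X) /\
       pmor (ev P (dual P X)) ≡ pev' (psext X) /\
       pmor (coev P (dual P X)) ≡ pcoev' (psext X)) /\
    (forall (X Y : pivotal_category M) (f : hom X Y),
       pmor (dualm P f) ≡ dual_mor (pcoev (psext X)) (pev (psext Y)) (pmor f)).
Proof.
exists (pivotal_monoidal M), (pivotal_structure M).
(* Every clause except the one on duals of morphisms holds by computation. *)
repeat split; intros; try constructor.
apply same_mor_of_eq, pmor_dualm.
Qed.
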